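(* Let $\Omega\in\mathcal B(\mathbb R^n)$ and let $\mu\in\mathrm{ba}(\Omega,\mathcal B(\Omega),\mathcal L^n)$ be a $0$-$1$ measure. Then $\operatorname{cor}\mu=\{x\}$ for some $x\in\widehat{\Omega}$, where $\widehat\Omega$ denotes the closure of $\Omega$ in $\widehat{\mathbb R^n}$. Moreover $\mu$ is pure and, if $x\in\overline\Omega$ (closure in $\mathbb R^n$), then $\mu\in\mathrm{Dens}_x$.
   Context: $\mathcal L^n$ is Lebesgue measure on $\mathbb R^n$, $\mathcal B(\Omega)$ the Borel subsets of $\Omega$. A measure on $\Omega$ means a finitely additive set function on $\mathcal B(\Omega)$ vanishing at $\emptyset$; a $\sigma$-measure is a countably additive one. $\mathrm{ba}(\Omega,\mathcal B(\Omega),\mathcal L^n)$ is the space of bounded real-valued finitely additive measures $\mu$ on $\mathcal B(\Omega)$ such that $\mu(A)=0$ whenever $\mathcal L^n(A)=0$; $|\mu|$ is the total variation. $\mu$ is pure if every $\sigma$-measure $\sigma$ on $\mathcal B(\Omega)$ with $0\le\sigma\le|\mu|$ is $0$. A nontrivial $\mu\in\mathrm{ba}(\Omega,\mathcal B(\Omega),\mathcal L^n)$ is a $0$-$1$ measure if $\mu(B)\in\{0,1\}$ for every $B\in\mathcal B(\Omega)$. $\widehat{\mathbb R^n}=\mathbb R^n\cup\{\infty\}$ is the one-point compactification. The core of $\mu$ is $$\operatorname{cor}\mu=\{x\in\widehat{\mathbb R^n}: |\mu|(U\cap\Omega)>0\text{ for all open }U\subset\widehat{\mathbb R^n}\text{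 with }x\in U\}.$$ For $x\in\overline\Omega$, $\mathrm{Dens}_x$ is the set of density measures at $x$ on $\Omega$, i.e. of all $\mu\in\mathrm{ba}(\Omega,\mathcal B(\Omega),\mathcal L^n)$ with $\mu\ge0$ and $\mu(B_\delta(x)\cap\Omega)=\mu(\Omega)=1$ for all $\delta>0$, where $B_\delta(x)$ is the open ball. *)

(* Defs.v *)
From mathcomp Require Import all_boot all_order all_algebra.
From mathcomp Require Import all_classical all_reals all_analysis.

Set Implicit Arguments.
Unset Strict Implicit.
Unset Printing Implicit Defensive.

Import Order.TTheory GRing.Theory Num.Theory.
Import numFieldNormedType.Exports.

Local Open Scope classical_set_scope.
Local Open Scope ring_scope.
Local Open Scope ereal_scope.

(* R^n is 'rV[R]_n with its product topology.  Set functions have type        *)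
(* set 'rV[R]_n -> \bar R; only their values on the Borel subsets of Omega    *)
(* are ever constrained or used.                                              *)

Definition borel (R : realType) (n : nat) : set_system 'rV[R]_n :=
  <<s [set U : set 'rV[R]_n | open U] >>.

Definition borel_on (R : realType) (n : nat) (Omega : set 'rV[R]_n) :
    set_system 'rV[R]_n :=
  [set A | borel A /\ A `<=` Omega].

Definition box (R : realType) (n : nat) (a b : 'rV[R]_n) : set 'rV[R]_n :=
  [set x | forall i : 'I_n, (a 0%R i <= x 0%R i <= b 0%R i)%R].

(* The cut-off at 0 gives empty boxes (b i < a i for some i) volume 0. *)
Definition box_volume (R : realType) (n : nat) (a b : 'rV[R]_n) : R :=
  (\prod_(i < n) Num.max 0 (b 0 i - a 0 i))%R.

(* Lebesgue outer measure for n >= 1: the infimum of the total volume over    *)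
(* countable covers by boxes.  Its restriction to the Borel sets is L^n.      *)
Definition lebesgue_Rn (R : realType) (n : nat) (A : set 'rV[R]_n) : \bar R :=
  ereal_inf [set \sum_(0 <= k <oo) (box_volume (ab k).1 (ab k).2)%:E |
    ab in [set ab : nat -> 'rV[R]_n * 'rV[R]_n |
            A `<=` \bigcup_k box (ab k).1 (ab k).2]].

Definition fin_additive_measure (R : realType) (n : nat)
    (Omega : set 'rV[R]_n) (mu : set 'rV[R]_n -> \bar R) : Prop :=
  mu set0 = 0 /\
  forall A B, borel_on Omega A -> borel_on Omega B -> A `&` B = set0 ->
    mu (A `|` B) = mu A + mu B.

Definition sigma_measure (R : realType) (n : nat)
    (Omega : set 'rV[R]_n) (sigma : set 'rV[R]_n -> \bar R) : Prop :=
  sigma set0 = 0 /\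
  forall F : nat -> set 'rV[R]_n,
    (forall k, borel_on Omega (F k)) -> trivIset setT F ->
    (fun m => \sum_(0 <= k < m) sigma (F k)) @ \oo --> sigma (\bigcup_k F k).

(* ba(Omega, B(Omega), L^n); the bound M : R also forces mu to be real-valued *)
(* on B(Omega).                                                               *)
Definition ba (R : realType) (n : nat) (Omega : set 'rV[R]_n) :
    set (set 'rV[R]_n -> \bar R) :=
  [set mu | [/\ fin_additive_measure Omega mu,
     exists M : R, forall A, borel_on Omega A -> `|mu A| <= M%:E
   & forall A, borel_on Omega A -> lebesgue_Rn A = 0 -> mu A = 0]].

(* |mu|(A): supremum over the finite Borel partitions of A. *)
Definition set_variation (R : realType) (n : nat)
    (mu : set 'rV[R]_n -> \bar R) (A : set 'rV[R]_n) : \bar R :=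
  ereal_sup [set s | exists (k : nat) (F : 'I_k -> set 'rV[R]_n),
    [/\ forall i, borel (F i), trivIset setT F, \bigcup_i F i = A
      & s = \sum_(i < k) `|mu (F i)|]].

Definition pure (R : realType) (n : nat) (Omega : set 'rV[R]_n)
    (mu : set 'rV[R]_n -> \bar R) : Prop :=
  forall sigma : set 'rV[R]_n -> \bar R,
    sigma_measure Omega sigma ->
    (forall A, borel_on Omega A -> 0 <= sigma A <= set_variation mu A) ->
    forall A, borel_on Omega A -> sigma A = 0.

Definition zero_one_measure (R : realType) (n : nat) (Omega : set 'rV[R]_n)
    (mu : set 'rV[R]_n -> \bar R) : Prop :=
  (exists2 B, borel_on Omega B & mu B <> 0) /\
  forall B, borel_on Omega B -> mu B = 0 \/ mu B = 1.

(* In one_point_compactification X, which is option X, the point at infinity  *)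
(* is None and X is embedded by Some.                                         *)
Definition core (R : realType) (n : nat) (Omega : set 'rV[R]_n)
    (mu : set 'rV[R]_n -> \bar R) : set (one_point_compactification 'rV[R]_n) :=
  [set x | forall U : set (one_point_compactification 'rV[R]_n),
    open U -> U x -> 0 < set_variation mu (Some @^-1` U `&` Omega)].

Definition hat_closure (R : realType) (n : nat) (Omega : set 'rV[R]_n) :
    set (one_point_compactification 'rV[R]_n) :=
  closure (Some @` Omega : set (one_point_compactification 'rV[R]_n)).

(* Euclidean ball; the library's ball on 'rV[R]_n is that of the sup norm. *)
Definition euclidean_ball (R : realType) (n : nat) (x : 'rV[R]_n) (r : R) :
    set 'rV[R]_n :=
  [set y | (Num.sqrt (\sum_(i < n) (y 0 i - x 0 i) ^+ 2) < r)%R].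

Definition Dens (R : realType) (n : nat) (Omega : set 'rV[R]_n)
    (x : 'rV[R]_n) : set (set 'rV[R]_n -> \bar R) :=
  [set mu | [/\ ba Omega mu,
     forall A, borel_on Omega A -> 0 <= mu A
   & forall delta : R, (0 < delta)%R ->
       mu (euclidean_ball x delta `&` Omega) = mu Omega /\ mu Omega = 1]].

(* Main.v *)
Require Import Defs.
From mathcomp Require Import all_boot all_order all_algebra.
From mathcomp Require Import all_classical all_reals all_analysis.
Import numFieldNormedType.Exports.
Local Open Scope classical_set_scope.
Set Implicit Arguments.
Unset Strict Implicit.
Unset Printing Implicit Defensive.
Import Order.TTheory GRing.Theory Num.Theory.
Local Open Scope ereal_scope.

(** A 0-1 measure [mu] behaves like an ultrafilter: call a Borel subset [A] of
    [Omega] full when [mu A = 1].  By finite additivity full sets are stable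
    under intersection ([zero_one_setI]), and of a Borel set and its complement
    exactly one has a full trace on [Omega] ([zero_one_setC]).

    The full sets therefore generate a proper filter on the one-point
    compactification of R^n.  By compactness this filter clusters at some point
    [x], which lies in the closure of [Omega].  For every open [U] around [x]
    the complement of [U] cannot be full, so [U] is; as [mu] is nonnegative it is
    its own total variation, and [x] is in the core ([zero_one_core_nonempty]).
    Two core points cannot have disjoint neighbourhoods, because the traces of
    these would be full and disjoint; the compactification being Hausdorff, the
    core is a single point ([zero_one_core_unique]).

    For purity, a countably additive [sigma] with [0 <= sigma <= mu] vanishes on
    every [mu]-null set, so it is enough to cover [Omega] by countably many null
    Borel sets ([zero_one_pure_null_cover]).  If [x] is at infinity, the closed
    balls of integer radius about the origin do, since their complements are
    neighbourhoods of [x].  If [x = y] is in R^n, the complements of the balls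
    of radius [1/k] about [y] do, together with the singleton of [y], which is
    null because [mu] ignores Lebesgue null sets.  This is where absolute continuity
    enters: a Dirac mass is a 0-1 measure, but it is not pure.

    Finally, every Euclidean ball about a core point [y] of R^n is an open
    neighbourhood, hence full, which is the density property at [y]. *)

(** * Topology of R^n and of its one-point compactification *)

(** Points of [X] are separated as in [X]; local compactness serves to separate
    [x] from infinity, by a compact neighbourhood of [x] and its complement. *)
Lemma one_point_compactification_hausdorff (X : topologicalType) :
  locally_compact [set: X] -> hausdorff_space X ->
  hausdorff_space (one_point_compactification X).
Proof.
move=> lcX hX.
have sep (x : X) :
    ~ cluster (nbhs (Some x : one_point_compactification X)) None.
  move=> clx; have := lcX x I; rewrite withinET => -[K xK [cK clK]].
  have nK : nbhs (None : one_point_compactification X)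
    (Some @` (~` K) `|` [set None]) by exists K.
  have [_ [[z Kz <-] [[w nKw [wz]]|//]]] := clx _ _
    (one_point_compactification_some_nbhs _ _ xK) nK.
  by apply: nKw; rewrite wz.
move=> [x|] [y|] //; [|by move/sep|by rewrite /cluster/= meetsC => /sep].
move=> clxy; congr Some; apply: hX => A B xA yB.
have [_ [[z Az <-] [w Bw [wz]]]] := clxy _ _
  (one_point_compactification_some_nbhs _ _ xA)
  (one_point_compactification_some_nbhs _ _ yB).
by exists z; split => //; rewrite -wz.
Qed.

Lemma closed_ball_compact_rV (R : realType) (n : nat) (x : 'rV[R]_n) (r : R) :
  (0 < r)%R -> compact (closed_ball x r).
Proof.
move=> r0; apply: bounded_closed_compact; last exact: closed_ball_closed.
exists (`|x| + r)%R; split; first exact: num_real.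
move=> M xrM z; rewrite closed_ballE// /closed_ball_/= => xz.
rewrite (le_trans _ (ltW xrM))// -(subrK x z) addrC.
rewrite (le_trans (ler_normD _ _))//.
by rewrite lerD2l distrC.
Qed.

Lemma locally_compact_rV (R : realType) (n : nat) :
  locally_compact [set: 'rV[R]_n].
Proof.
move=> x _; rewrite withinET; exists (closed_ball x 1%R).
  by apply/nbhs_closedballP; exists (PosNum ltr01).
by split; [exact: closed_ball_compact_rV | exact: closed_ball_closed].
Qed.

Lemma open_euclidean_ball (R : realType) (n : nat) (x : 'rV[R]_n) (r : R) :
  open (euclidean_ball x r).
Proof.
pose q (y : 'rV[R]_n) := (\sum_(i < n) (y 0 i - x 0 i) ^+ 2)%R.
have cq : continuous q.
  apply: continuous_big => [|i _ y].
    by move=> z; exact: (@cvgD _ R^o _ _ _ _ _ _ _ cvg_fst cvg_snd).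
  apply: (@continuous_comp _ _ _ (fun z : 'rV[R]_n => z 0%R i - x 0%R i)%R
    (fun t => t ^+ 2)%R); last exact: exprn_continuous.
  apply: (@continuousB _ R^o); last exact: cst_continuous.
  exact: coord_continuous.
have -> : euclidean_ball x r = (Num.sqrt \o q) @^-1` [set t | (t < r)%R] by [].
apply: open_comp; last exact: open_lt.
by move=> y _; apply: continuous_comp; [exact: cq|exact: sqrt_continuous].
Qed.

(** * Borel sets of R^n and Lebesgue null points *)

(** The degenerate box from [x] to [x] has a side of length 0 as soon as there
    is a coordinate. *)
Lemma lebesgue_Rn_set1 (R : realType) (n : nat) (x : 'rV[R]_n) :
  (0 < n)%N -> lebesgue_Rn [set x] = 0.
Proof.
move=> n0; apply/eqP; rewrite eq_le; apply/andP; split.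
  apply: ereal_inf_lbound => /=; exists (fun=> (x, x)).
    by move=> _ ->; exists 0%N => //= i; rewrite !lexx.
  rewrite eseries0// => k _ _ /=.
  rewrite /box_volume (bigD1 (Ordinal n0))//= subrr maxxx mul0r//.
apply: le_ereal_inf_tmp => _ [ab _ <-]; apply: nneseries_ge0 => k _ _.
by rewrite lee_fin; apply: prodr_ge0 => i _; rewrite le_max lexx.
Qed.

Lemma borel_open (R : realType) (n : nat) (U : set 'rV[R]_n) :
  open U -> borel U.
Proof. exact: sub_sigma_algebra. Qed.

Lemma borel_preimage_Some (R : realType) (n : nat)
    (U : set (one_point_compactification 'rV[R]_n)) :
  open U -> borel (Some @^-1` U).
Proof.
move=> oU; apply: borel_open; apply: open_comp oU => y _.
exact: one_point_compactification_some_continuous.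
Qed.

Lemma borelC (R : realType) (n : nat) (A : set 'rV[R]_n) :
  borel A -> borel (~` A).
Proof. exact: sigma_algebraC. Qed.

Lemma borel_closed (R : realType) (n : nat) (A : set 'rV[R]_n) :
  closed A -> borel A.
Proof.
by move=> cA; rewrite -(setCK A); apply: borelC; apply: borel_open;
  exact: closed_openC.
Qed.

Lemma borel_set1 (R : realType) (n : nat) (x : 'rV[R]_n) : borel [set x].
Proof.
apply: borel_closed; apply: accessible_closed_set1; apply: hausdorff_accessible.
exact: norm_hausdorff.
Qed.

Lemma borel_onS (R : realType) (n : nat) (Omega A B : set 'rV[R]_n) :
  borel_on Omega A -> borel B -> B `<=` A -> borel_on Omega B.
Proof. by move=> [_ AO] bB BA; split => //; exact: subset_trans AO. Qed.

Lemma borel_onI (R : realType) (n : nat) (Omega A B : set 'rV[R]_n) :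
  borel_on Omega A -> borel B -> borel_on Omega (A `&` B).
Proof.
move=> [bA AO] bB; split; last by move=> z [/AO].
exact: (@measurableI _ (g_sigma_algebraType [set U : set 'rV[R]_n | open U])).
Qed.

Lemma borel_onD (R : realType) (n : nat) (Omega A B : set 'rV[R]_n) :
  borel_on Omega A -> borel B -> borel_on Omega (A `\` B).
Proof. by move=> bA bB; rewrite setDE; apply: borel_onI (borelC bB). Qed.

Lemma borel_onU (R : realType) (n : nat) (Omega A B : set 'rV[R]_n) :
  borel_on Omega A -> borel_on Omega B -> borel_on Omega (A `|` B).
Proof.
move=> [bA AO] [bB BO]; split; last by move=> z [/AO|/BO].
exact: (@measurableU _ (g_sigma_algebraType [set U : set 'rV[R]_n | open U])).
Qed.

(** * Finitely additive measures and their total variation *)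

Lemma fin_additive_setID (R : realType) (n : nat) (Omega : set 'rV[R]_n)
    (mu : set 'rV[R]_n -> \bar R) (A B : set 'rV[R]_n) :
  fin_additive_measure Omega mu -> borel_on Omega A -> borel B ->
  mu A = mu (A `&` B) + mu (A `\` B).
Proof.
move=> [_ muD] bA bB; rewrite -muD; last by rewrite setDE setIACA setICr setI0.
- by rewrite setUIDK.
- exact: borel_onI.
- exact: borel_onD.
Qed.

Lemma fin_additive_bigcup (R : realType) (n : nat) (Omega : set 'rV[R]_n)
    (mu : set 'rV[R]_n -> \bar R) (k : nat) (F : 'I_k -> set 'rV[R]_n) :
  fin_additive_measure Omega mu -> (forall i, borel_on Omega (F i)) ->
  trivIset setT F -> borel_on Omega (\bigcup_i F i) /\
  mu (\bigcup_i F i) = \sum_(i < k) mu (F i).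
Proof.
move=> [mu0 muD]; elim: k F => [F _ _|k IH F bF tF].
  have -> : \bigcup_i F i = set0 by rewrite -subset0 => z [[]].
  rewrite big_ord0; split => //; split => //.
  exact: (@measurable0 _ (g_sigma_algebraType [set U : set 'rV[R]_n | open U])).
have [|bG muG] := IH (fun i => F (lift ord0 i)) (fun i => bF _).
  by move=> i j _ _ /(tF _ _ I I)/lift_inj.
have -> : \bigcup_i F i = F ord0 `|` \bigcup_i F (lift ord0 i).
  apply/seteqP; split => [z [i _ Fiz]|z [?|[i _ ?]]].
  - case: (unliftP ord0 i) Fiz => [j ->|->] ?; last by left.
    by right; exists j.
  - by exists ord0.
  - by exists (lift ord0 i).
split; first exact: borel_onU.
rewrite big_ord_recl -muG muD//; rewrite -subset0 => z [F0z [i _ Fiz]].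
by have := tF ord0 (lift ord0 i) I I (ex_intro _ z (conj F0z Fiz)).
Qed.

(** Along a finite partition the absolute values may be dropped, so that all
    the sums in the supremum are equal to [mu A] by finite additivity. *)
Lemma ge0_set_variationE (R : realType) (n : nat) (Omega : set 'rV[R]_n)
    (mu : set 'rV[R]_n -> \bar R) :
  fin_additive_measure Omega mu ->
  (forall A, borel_on Omega A -> 0 <= mu A) ->
  forall A, borel_on Omega A -> set_variation mu A = mu A.
Proof.
move=> addmu mu0 A bA; apply/eqP; rewrite eq_le; apply/andP; split.
  apply: ge_ereal_sup => _ [k [F [bF tF FA ->]]].
  have bOF i : borel_on Omega (F i).
    by apply: (borel_onS bA) => // z Fz; rewrite -FA; exists i.
  rewrite -FA (fin_additive_bigcup addmu bOF tF).2.
  by apply: lee_sum => i _; rewrite gee0_abs// mu0.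
apply: ereal_sup_ubound; exists 1%N, (fun=> A); split.
- by move=> _; exact: bA.1.
- by move=> i j; rewrite !ord1.
- by apply/seteqP; split => [z [//]|z Az]; exists ord0.
- by rewrite big_ord1 gee0_abs// mu0.
Qed.

(** * Sets of measure one and the core of a 0-1 measure *)

Section zero_one_measure.
Context (R : realType) (n : nat) (Omega : set 'rV[R]_n)
  (mu : set 'rV[R]_n -> \bar R) (bOmega : borel Omega)
  (addmu : fin_additive_measure Omega mu) (h01 : zero_one_measure Omega mu).

Let bOO : borel_on Omega Omega. Proof. by split. Qed.

Let bIO A : borel A -> borel_on Omega (A `&` Omega).
Proof. by rewrite setIC => bA; exact: borel_onI. Qed.

Lemma zero_one_ge0 A : borel_on Omega A -> 0 <= mu A.
Proof. by move=> /h01.2[->|->]. Qed.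

Lemma zero_one_le A B : borel_on Omega B -> borel A -> A `<=` B -> mu A <= mu B.
Proof.
move=> bB bA AB; rewrite (fin_additive_setID addmu bB bA) (setIidr AB) leeDl//.
by apply: zero_one_ge0; exact: borel_onD.
Qed.

Lemma zero_one_total : mu Omega = 1.
Proof.
have [B bB muB] := h01.1; have [muO|//] := h01.2 Omega bOO.
have := zero_one_le bOO bB.1 bB.2.
by have [//|->] := h01.2 B bB; rewrite muO lee_fin ler10.
Qed.

Lemma zero_one_setC A : borel A -> mu (~` A `&` Omega) = 1 - mu (A `&` Omega).
Proof.
move=> bA; have := fin_additive_setID addmu bOO bA.
rewrite zero_one_total setIC setDE (setIC Omega) => ->.
by have [->|->] := h01.2 _ (bIO bA); rewrite ?sube0 ?add0e//;
  rewrite addeAC subee ?add0e.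
Qed.

(** [B] minus [A] is contained in the complement of [A], which is null: removing
    it from [B] does not change the measure. *)
Lemma zero_one_setI A B : borel_on Omega A -> borel_on Omega B ->
  mu A = 1 -> mu B = 1 -> mu (A `&` B) = 1.
Proof.
move=> bA bB A1 B1; have := fin_additive_setID addmu bB bA.1.
have -> : mu (B `\` A) = 0.
  apply/eqP; rewrite eq_le zero_one_ge0 ?andbT; last exact: borel_onD bA.1.
  have <- : mu (~` A `&` Omega) = 0.
    by rewrite (zero_one_setC bA.1) (setIidl bA.2) A1 subee.
  apply: zero_one_le;
    [exact: (bIO (borelC bA.1))|exact: (borel_onD bB bA.1).1|].
  by move=> z [/bB.2 Oz nAz].
by rewrite adde0 B1 setIC.
Qed.

Lemma zero_one_variation A : borel_on Omega A -> set_variation mu A = mu A.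
Proof. exact: ge0_set_variationE addmu zero_one_ge0 _. Qed.

(** The core asks for positive variation only; a 0-1 measure has no positive
    value below 1. *)
Lemma zero_one_coreP (x : one_point_compactification 'rV[R]_n) :
  core Omega mu x <->
  forall U, open U -> U x -> mu (Some @^-1` U `&` Omega) = 1.
Proof.
have bU (U : set (one_point_compactification 'rV[R]_n)) :
    open U -> borel_on Omega (Some @^-1` U `&` Omega).
  by move=> oU; exact: (bIO (borel_preimage_Some oU)).
split=> cx U oU Ux; last by rewrite zero_one_variation ?cx//; exact: bU.
have := cx U oU Ux; rewrite zero_one_variation; last exact: bU.
by have [->|//] := h01.2 _ (bU _ oU); rewrite ltxx.
Qed.

Lemma zero_one_core_Some (y : 'rV[R]_n) (V : set 'rV[R]_n) :
  core Omega mu (Some y) -> open V -> V y -> mu (V `&` Omega) = 1.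
Proof.
move=> /zero_one_coreP cy oV Vy.
have <- : Some @^-1` (Some @` V) = V.
  by apply/seteqP; split => [z [w Vw [<-]]//|z Vz]; exists z.
by apply: cy; [exact: one_point_compactification_open_some|exists y].
Qed.

(** Complements of compact closed sets are the traces on R^n of the basic open
    neighbourhoods of infinity. *)
Lemma zero_one_core_None (K : set 'rV[R]_n) :
  core Omega mu None -> compact K -> closed K -> mu (~` K `&` Omega) = 1.
Proof.
move=> /zero_one_coreP cN cK clK.
pose U : set (one_point_compactification 'rV[R]_n) :=
  Some @` (~` K) `|` [set None].
have <- : Some @^-1` U = ~` K.
  by apply/seteqP; split => [z [[w nKw [<-]]//|//]|z nKz]; left; exists z.
apply: cN; last by right.
rewrite openE => -[z|_]; last by exists K.
move=> [[w nKw [<-]]|//]; apply: filterS (@subsetUl _ _ _) _.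
apply: one_point_compactification_some_nbhs; apply: open_nbhs_nbhs.
by split => //; exact: closed_openC.
Qed.

(** The point is a cluster point of the filter that the sets of measure 1
    generate on the compactification: it exists by compactness, and it is in the
    closure of [Omega] because [Omega] has measure 1. *)
Lemma zero_one_core_nonempty :
  exists2 x, hat_closure Omega x & core Omega mu x.
Proof.
pose opc : topologicalType := one_point_compactification 'rV[R]_n.
pose F : set_system opc := filter_from
  [set A | borel_on Omega A /\ mu A = 1] (fun A => Some @` A).
have FF : ProperFilter F.
  apply: filter_from_proper; last first.
    move=> A [bA A1]; have [A0|/set0P[z Az]] := eqVneq A set0.
      by move: A1; rewrite A0 addmu.1 => /eqP; rewrite eqe eq_sym oner_eq0.
    by exists (Some z), z.
  apply: filter_from_filter; first by exists Omega => //;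
    split; [|exact: zero_one_total].
  move=> A B [bA A1] [bB B1]; exists (A `&` B).
    by split; [exact: borel_onI bB.1|exact: zero_one_setI].
  by move=> _ [z [Az Bz] <-]; split; exists z.
have [x [_ clx]] := one_point_compactification_compact _ FF filterT.
exists x.
  move=> B xB; apply: clx => //; exists Omega => //.
  by split; [|exact: zero_one_total].
(* If U were null, its complement would be full, and the cluster point x would
   make it meet U. *)
apply/zero_one_coreP => U oU Ux.
have bU := borel_preimage_Some oU.
have [U0|//] := h01.2 _ (bIO bU).
have [||_ [[z [nUz _] <-]]//] := clx (Some @` (~` (Some @^-1` U) `&` Omega)) U.
- exists (~` (Some @^-1` U) `&` Omega) => //.
  split; first exact: (bIO (borelC bU)).
  by rewrite zero_one_setC// U0 sube0.
- exact: open_nbhs_nbhs.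
Qed.

Lemma zero_one_core_unique (x y : one_point_compactification 'rV[R]_n) :
  core Omega mu x -> core Omega mu y -> x = y.
Proof.
move=> /zero_one_coreP cx /zero_one_coreP cy.
apply: (one_point_compactification_hausdorff (@locally_compact_rV R n)
  (@norm_hausdorff _ _)) => A B.
rewrite !nbhsE => -[U [oU Ux] UA] [V [oV Vy] VB].
have := zero_one_setI (bIO (borel_preimage_Some oU))
  (bIO (borel_preimage_Some oV)) (cx _ oU Ux) (cy _ oV Vy).
have [->|/set0P[z [[Uz _] [Vz _]]] _] := eqVneq
    ((Some @^-1` U `&` Omega) `&` (Some @^-1` V `&` Omega)) set0.
  by rewrite addmu.1 => /eqP; rewrite eqe eq_sym oner_eq0.
by exists (Some z); split; [exact: UA|exact: VB].
Qed.

(** * Purity of a 0-1 measure *)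

(** Once the cover is made disjoint, countable additivity writes [sigma A] as a
    series of values of [sigma] on null sets, which [mu] bounds by 0. *)
Lemma zero_one_pure_null_cover (E : nat -> set 'rV[R]_n) :
  (forall k, borel (E k)) -> (forall k, mu (E k `&` Omega) = 0) ->
  Omega `<=` \bigcup_k E k -> pure Omega mu.
Proof.
move=> bE E0 OE sigma [sigma0 sigmaD] sigma_le A bA.
pose G k := A `&` seqDU E k.
have bG k : borel_on Omega (G k).
  apply: borel_onI => //.
  exact: (@seqDU_measurable _
    (g_sigma_algebraType [set U : set 'rV[R]_n | open U])).
have AG : A = \bigcup_k G k.
  rewrite -setI_bigcupr -seqDU_bigcup_eq.
  exact/esym/setIidl/(subset_trans bA.2).
have tG : trivIset setT G by apply: trivIset_setIl; exact: trivIset_seqDU.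
have G0 k : sigma (G k) = 0.
  have /andP[s0 sle] := sigma_le _ (bG k).
  apply/eqP; rewrite eq_le s0 andbT (le_trans sle)// zero_one_variation//.
  rewrite -(E0 k); apply: zero_one_le; [exact: bIO|exact: (bG k).1|].
  by move=> z [Az Gz]; split; [exact: subset_seqDU Gz|exact: bA.2 Az].
have := sigmaD G bG tG; rewrite -AG.
under eq_fun do rewrite big1//.
by move/(cvg_unique _ (cvg_cst _)) => /(_ (@ereal_hausdorff _)) ->.
Qed.

(** The null cover consists of closed sets that stay away from the core point
    [x], completed by [x] itself when it is in R^n. *)
Lemma zero_one_pure (x : one_point_compactification 'rV[R]_n) :
  (forall y, Omega y -> mu [set y] = 0) -> core Omega mu x -> pure Omega mu.
Proof.
move=> mu1 cx.
have null (K : set 'rV[R]_n) : closed K ->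
    mu (~` K `&` Omega) = 1 -> mu (K `&` Omega) = 0.
  move=> clK; rewrite -{2}(setCK K) => nK; rewrite zero_one_setC ?nK ?subee//.
  by apply: borelC; exact: borel_closed.
case: x cx => [y|] cx.
- pose E k := if k is k'.+1 then ~` ball y k'.+1%:R^-1 else [set y].
  apply: (@zero_one_pure_null_cover E) => [[|k]|[|k]|z Oz].
  + exact: borel_set1.
  + by apply: borelC; apply: borel_open; apply: ball_open.
  + have [Oy|nOy] := pselect (Omega y).
      by rewrite (setIidl _) ?mu1// => _ ->.
    suff -> : [set y] `&` Omega = set0 by exact: addmu.1.
    by rewrite -subset0 => z [->].
  + apply: null; first exact/open_closedC/ball_open.
    rewrite setCK; apply: (zero_one_core_Some cx); first exact: ball_open.
    exact: ballxx.
  have [->|yz] := eqVneq z y; first by exists 0%N.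
  have [k] : exists k, (0 + k.+1%:R^-1 < `|y - z|)%R.
    by apply: ltr_add_invr; rewrite normr_gt0 subr_eq0 eq_sym.
  rewrite add0r => kyz; exists k.+1 => //=.
  rewrite -ball_normE /ball_/= => /(lt_trans kyz).
  by rewrite ltxx.
- apply: (@zero_one_pure_null_cover (fun k => closed_ball 0%R k.+1%:R))
    => [k|k|z Oz].
  + by apply: borel_closed; exact: closed_ball_closed.
  + apply: null; first exact: closed_ball_closed.
    apply: (zero_one_core_None cx); last exact: closed_ball_closed.
    exact: closed_ball_compact_rV.
  exists (Num.truncn `|z|) => //.
  rewrite closed_ballE// /closed_ball_/= sub0r normrN.
  exact/ltW/truncnS_gt.
Qed.

End zero_one_measure.

(** * The core, purity and density of 0-1 measures *)

Theorem theorem4p1 (R : realType) (n : nat) (hn : (0 < n)%N)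
    (Omega : set 'rV[R]_n) (hOmega : borel Omega)
    (mu : set 'rV[R]_n -> \bar R) (hmu : ba Omega mu)
    (h01 : zero_one_measure Omega mu) :
  exists x : one_point_compactification 'rV[R]_n,
    [/\ hat_closure Omega x,
        core Omega mu = [set x],
        pure Omega mu
      & forall y : 'rV[R]_n, x = Some y -> closure Omega y -> Dens Omega y mu].
Proof.
have [addmu _ mu_null] := hmu.
have [x hatx cx] := zero_one_core_nonempty hOmega addmu h01.
exists x; split => //.
- apply/seteqP; split=> [y cy|_ ->//].
  exact: (zero_one_core_unique hOmega addmu h01).
- apply: (zero_one_pure hOmega addmu h01 _ cx) => y Oy; apply: mu_null.
    split; last by move=> _ ->.
    exact: borel_set1.
  exact: lebesgue_Rn_set1.
move=> y xy _; split => // [|delta d0]; first exact: zero_one_ge0.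
rewrite (zero_one_total hOmega addmu h01); split => //.
rewrite xy in cx; apply: (zero_one_core_Some hOmega addmu h01 cx).
  exact: open_euclidean_ball.
rewrite /euclidean_ball/= big1 ?sqrtr0// => i _.
by rewrite subrr expr0n.
Qed.
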